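(* For $n\geq 1$, the number of permutations $\pi\in\mathcal{S}_n$ such that $\pi^2$ has exactly one descent and that descent is at position $1$ equals \[\sum_{i=1}^{\lfloor\frac{n-1}{2}\rfloor} e_{n-(2i+1)},\] where $e_j$ denotes the number of involutions in $\mathcal{S}_j$ (with $e_0=1$).
   Context: $\mathcal{S}_n$ is the symmetric group on $[n]$; a permutation $\sigma=\sigma_1\cdots\sigma_n$ (one-line notation) has a descent at position $i\in[n-1]$ if $\sigma_i>\sigma_{i+1}$. $\pi^2(i)=\pi(\pi(i))$. An involution is a permutation $\tau$ with $\tau^2$ the identity. *)

(* Defs.v *)
From mathcomp Require Import all_boot all_fingroup.

Set Implicit Arguments.
Unset Strict Implicit.
Unset Printing Implicit Defensive.

(* 'S_n permutes {0, ..., n-1}, whereas positions are numbered from 1: the     *)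
(* entry at position k is the image of the ordinal of value k-1, so a descent *)
(* at position k compares the images of the ordinals k-1 and k.               *)
Definition descent_at (n : nat) (s : 'S_n) (k : nat) : bool :=
  [exists i : 'I_n, exists j : 'I_n, [&& i.+1 == k, j == k :> nat & s j < s i]].

Definition descents (n : nat) (s : 'S_n) : seq nat :=
  [seq k <- iota 1 n.-1 | descent_at s k].

Definition involutions (n : nat) : {set 'S_n} :=
  [set t : 'S_n | (t ^+ 2 == 1)%g].

(* Main.v *)
Require Import Defs.
From mathcomp Require Import all_boot all_fingroup.
From mathcomp Require Import zify.

Set Implicit Arguments.
Unset Strict Implicit.
Unset Printing Implicit Defensive.

(* A permutation whose only descent is at position 1 is determined by its     *)
(* first value k > 0 (counting from 0): it is the cycle (0 k k-1 ... 1) on    *)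
(* {0, ..., k}, which is lift_perm ord0 k 1.  A square root p of this cycle   *)
(* commutes with it, so it acts on {0, ..., k} as one of its powers; this     *)
(* forces k+1 to be odd.  For k+1 odd the cycle has a root among its own      *)
(* powers, and dividing p by this root leaves an involution commuting with    *)
(* the cycle, which is the same as an involution fixing 0, ..., k.            *)

(** The count is sorted by the value [k] of [p ^+ 2] at 0. By [descents_eq1P] each [k > 0] leaves
    one possible square, the cycle above, and [card_sqrt_cycle] counts its roots: none for odd [k],
    and for even [k] as many as there are involutions of the points above [k]. There are n - (k + 1)
    such points in a set of size n ([card_involutions_fix]), so putting k = 2i gives the sum. *)

Lemma lift_perm_surj n (i : 'I_n.+1) (s : 'S_n.+1) :
  exists s' : 'S_n, s = lift_perm i (s i) s'.
Proof.
(* The [unlift] always succeeds: [lift i k] differs from [i], so its image differs from [s i]. *)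
pose f k := odflt k (unlift (s i) (s (lift i k))).
have fE k : lift (s i) (f k) = s (lift i k).
  rewrite /f; case: unliftP => [j -> // | /perm_inj /esym/eqP].
  by rewrite (negPf (neq_lift i k)).
have f_inj : injective f.
  by move=> x y /(congr1 (lift (s i))); rewrite !fE => /perm_inj/lift_inj.
exists (perm f_inj); apply/permP=> x.
case: (unliftP i x) => [j ->|->]; last by rewrite lift_perm_id.
by rewrite lift_perm_lift permE fE.
Qed.

(** Increasing values force [m <= s m] for every [m]; both sides have the same sum over all [m], so
    every inequality is an equality. *)
Lemma increasing_perm_eq1 n (s : 'S_n) :
  (forall i j : 'I_n, j = i.+1 :> nat -> s i < s j) -> s = 1%g.
Proof.
move=> s_incr.
have le_s m (ltmn : m < n) : m <= s (Ordinal ltmn).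
  elim: m ltmn => // m IHm ltmn.
  exact: leq_ltn_trans (IHm (ltnW ltmn)) (s_incr (Ordinal (ltnW ltmn)) _ _).
have /leqif_sum : forall i : 'I_n, true -> (i : nat) <= s i ?= iff (i == s i).
  by move=> [m ltmn] _; split; [exact: le_s |].
case=> _; rewrite [X in _ == X](_ : _ = \sum_(i < n) (i : nat)); last first.
  by rewrite [RHS](reindex_inj (@perm_inj _ s)).
rewrite eqxx => /esym/forall_inP s_id; apply/permP=> i.
by rewrite perm1 -(eqP (s_id i isT)).
Qed.

(** Fixed points are removed one at a time: the permutations fixing 0 are the lifts
    [lift_perm ord0 ord0 u], and lifting preserves being an involution while shifting the other
    fixed points by one. *)
Lemma card_involutions_fix m n : m <= n ->
  #|[set t in involutions n | [forall i : 'I_n, (i < m) ==> (t i == i)]]|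
    = #|involutions (n - m)|.
Proof.
elim: m n => [n _ | m IHm [//|n] lemn].
  rewrite subn0; apply: eq_card => t; rewrite inE andb_idr // => _.
  exact/forallP.
rewrite subSS -IHm //.
have lift_inj0 : injective (@lift_perm n ord0 ord0).
  move=> s t eq_st; apply/permP=> i; apply: (@lift_inj _ ord0).
  by rewrite -!(lift_perm_lift ord0) eq_st.
rewrite -(card_imset _ lift_inj0); apply: eq_card => t.
have liftE (u : 'S_n) : (lift_perm ord0 ord0 u \in
    [set t in involutions n.+1 | [forall i : 'I_n.+1, (i < m.+1) ==> (t i == i)]])
  = (u \in [set t in involutions n | [forall i : 'I_n, (i < m) ==> (t i == i)]]).
  rewrite !inE !expgS !expg0 !mulg1 lift_permM -(@lift_perm1 n ord0).
  rewrite (inj_eq lift_inj0); congr (_ && _).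
  apply/forall_inP/forall_inP => u_id i lt_im.
    have := u_id (lift ord0 i); rewrite lift_perm_lift (inj_eq lift_inj).
    by apply.
  case: (unliftP ord0 i) lt_im => [j ->|->] lt_im; last by rewrite lift_perm_id.
  by rewrite lift_perm_lift (inj_eq lift_inj) u_id.
apply/idP/imsetP => [t_in | [u u_in ->]]; last by rewrite liftE.
have t0 : t ord0 = ord0.
  by move: t_in; rewrite !inE => /andP[_ /forall_inP/(_ ord0 isT)/eqP].
have [u tE] := lift_perm_surj ord0 t; rewrite t0 in tE.
by exists u; rewrite -?liftE -?tE.
Qed.

Section Cycle.

Variables (n : nat) (k : 'I_n.+1).
Hypothesis k_gt0 : 0 < k.

(** The inverse of the target cycle, with the same square-root and commutation questions; its powers
    are easy to read, since [d ^+ j] sends 0 to [j] for [j <= k]. *)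
Let d : 'S_n.+1 := lift_perm k ord0 1.

Lemma cycleV : (lift_perm ord0 k 1)^-1%g = d.
Proof. by rewrite lift_permV invg1. Qed.

Lemma cycle_lt (i : 'I_n.+1) : i < k -> d i = i.+1 :> nat.
Proof.
case: (unliftP k i) => [j ->|->]; last by rewrite ltnn.
by rewrite lift_perm_lift perm1 /= /bump; lia.
Qed.

Lemma cycle_gt (i : 'I_n.+1) : k < i -> d i = i.
Proof.
case: (unliftP k i) => [j ->|->]; last by rewrite ltnn.
by rewrite lift_perm_lift perm1 /= /bump => lt; apply: ord_inj => /=; rewrite /bump; lia.
Qed.

Lemma cycle_leq (i : 'I_n.+1) : i <= k -> d i <= k.
Proof.
rewrite leq_eqVlt => /predU1P[/ord_inj->|ltik]; first by rewrite lift_perm_id.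
by rewrite cycle_lt.
Qed.

Lemma cycleX_gt j (i : 'I_n.+1) : k < i -> (d ^+ j)%g i = i.
Proof.
move=> ltki; elim: j => [|j IHj]; first by rewrite perm1.
by rewrite expgSr permM IHj cycle_gt.
Qed.

Lemma cycleX_leq (i : 'I_n.+1) : i <= k -> (d ^+ i)%g ord0 = i.
Proof.
move=> le_ik; suff H j : j <= k -> (d ^+ j)%g ord0 = j :> nat.
  by apply: ord_inj; apply: H.
elim: j => [|j IHj] ltjk; first by rewrite perm1.
by rewrite expgSr permM cycle_lt IHj // ltnW.
Qed.

Lemma cycle_order : (d ^+ k.+1 = 1)%g.
Proof.
apply/permP=> i; rewrite perm1; have [leik|ltki] := leqP i k; last exact: cycleX_gt.
rewrite -{1}(cycleX_leq leik) -permM -expgD addnC expgD permM expgSr permM.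
by rewrite cycleX_leq // lift_perm_id cycleX_leq.
Qed.

Lemma cycleX0 j : (d ^+ j)%g ord0 = j %% k.+1 :> nat.
Proof.
rewrite -(expg_mod _ cycle_order).
have ltjn : j %% k.+1 < n.+1.
  by apply: leq_trans (ltn_ord k); rewrite ltn_pmod.
by rewrite (cycleX_leq (i := Ordinal ltjn)) //= -ltnS ltn_pmod.
Qed.

(** [q] cannot send 0, which [d] moves, to a point fixed by [d], so [q ord0 <= k]. Writing [i] as
    [d ^+ i] applied to 0, commutation determines [q i] from [q ord0]. *)
Lemma commute_cycleE (q : 'S_n.+1) : commute q d ->
  forall i : 'I_n.+1, i <= k -> q i = (d ^+ q ord0)%g i.
Proof.
move=> cqd.
have q0_le : q ord0 <= k.
  rewrite leqNgt; apply/negP => /cycle_gt; rewrite -permM cqd permM.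
  move/perm_inj/(congr1 val)=> /=; by rewrite cycle_lt.
move=> i le_ik; rewrite -{1 2}(cycleX_leq le_ik) -!permM -expgD addnC expgD.
by rewrite -(commuteX i cqd) !permM cycleX_leq.
Qed.

Lemma commute_cycle_sqr0 (q : 'S_n.+1) : commute q d ->
  (q ^+ 2)%g ord0 = (2 * q ord0) %% k.+1 :> nat.
Proof.
move=> cqd; have q0E := commute_cycleE cqd (leq0n k : ord0 <= k).
rewrite expgS expg1 permM {1}q0E -permM -(commuteX _ cqd) permM {2}q0E -permM.
by rewrite -expgD addnn -mul2n cycleX0.
Qed.

Lemma sqrt_cycle_commute (p : 'S_n.+1) :
  (p ^+ 2 = lift_perm ord0 k 1)%g -> commute p d.
Proof. by move=> p2; rewrite -cycleV -p2; apply/commuteV/commuteX. Qed.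

(** Here [k] is twice [p ord0] modulo [k.+1]; an even modulus would make this residue even, and
    hence [k] even. *)
Lemma sqrt_cycle_even (p : 'S_n.+1) :
  (p ^+ 2 = lift_perm ord0 k 1)%g -> ~~ odd k.
Proof.
move=> p2; have := commute_cycle_sqr0 (sqrt_cycle_commute p2).
rewrite p2 lift_perm_id => /(congr1 odd).
have [kodd|//] := boolP (odd k).
by rewrite odd_mod ?oddM //= kodd.
Qed.

(** If [t] commutes with [d], the odd number [k.+1] divides [2 * t ord0], hence [t ord0], so the
    power of [d] by which [t] acts is trivial. Conversely, the supports of [t] and [d] are
    disjoint. *)
Lemma commute_cycle_involution (t : 'S_n.+1) : ~~ odd k -> (t ^+ 2 = 1)%g ->
  commute t d <-> (forall i : 'I_n.+1, i <= k -> t i = i).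
Proof.
move=> keven t2; split=> [ctd | t_id].
  have /eqP := commute_cycle_sqr0 ctd; rewrite t2 perm1 eq_sym -/(dvdn _ _).
  rewrite Gauss_dvdr ?coprimen2 //= => dvd_t0 i le_ik.
  by rewrite (commute_cycleE ctd) // -(expg_mod _ cycle_order) (eqP dvd_t0) perm1.
apply/permP=> i; rewrite !permM; have [leik|ltki] := leqP i k.
  by rewrite !t_id // cycle_leq.
rewrite (cycle_gt ltki) cycle_gt // ltnNge; apply: contraL ltki => le_ti.
rewrite -leqNgt; suff <- : t i = i by [].
by apply: (@perm_inj _ t); exact: t_id.
Qed.

Lemma card_sqrt_cycle :
  #|[set p : 'S_n.+1 | (p ^+ 2)%g == lift_perm ord0 k 1]|
    = if odd k then 0 else #|involutions (n - k)|.
Proof.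
case: ifPn => [kodd | keven].
  apply/eqP; rewrite cards_eq0; apply/eqP/setP=> p; rewrite !inE.
  by apply/negP=> /eqP/sqrt_cycle_even; rewrite kodd.
rewrite -subSS -card_involutions_fix //.
(* [a] is the inverse of 2 modulo [k.+1], so [d ^- a] is a square root of the target cycle, and the
   set of all roots is the right coset by [d ^- a] of the involutions fixing 0, ..., k. *)
pose a := k./2.+1; have aE : a * 2 = 1 + k.+1 by rewrite /a; lia.
have d2a : (d ^+ (a * 2) = d)%g by rewrite aE expgD cycle_order mulg1 expg1.
rewrite -[RHS](card_rcoset _ (d ^- a)%g); apply: eq_card => p.
rewrite mem_rcoset invgK !inE; apply/eqP/andP => [p2 | [/eqP t2 /forall_inP t_id]].
  have cpd := sqrt_cycle_commute p2.
  have t2 : ((p * d ^+ a) ^+ 2 = 1)%g.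
    by rewrite (expgMn 2 (commuteX a cpd)) -expgM d2a p2 -cycleV mulgV.
  split; first exact/eqP.
  apply/forall_inP=> i le_ik; apply/eqP.
  apply: (proj1 (commute_cycle_involution keven t2)) => //.
  by apply/commute_sym/commuteM; [exact: commute_sym | exact/commuteX].
have ctd : commute (p * d ^+ a)%g d.
  by apply/commute_cycle_involution => // i le_ik; apply/eqP/t_id.
rewrite -[p](mulgK (d ^+ a)%g) (expgMn 2 (commuteV (commuteX a ctd))).
by rewrite t2 mul1g expVgn -expgM d2a -cycleV invgK.
Qed.

End Cycle.

Lemma descent_atE n (s : 'S_n.+1) (i j : 'I_n.+1) :
  j = i.+1 :> nat -> descent_at s j = (s j < s i).
Proof.
move=> jE; apply/existsP/idP => [[i' /existsP[j' /and3P[/eqP ei /eqP ej]]]|lt_ji].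
  have -> : i' = i by apply: ord_inj; lia.
  by have -> : j' = j by apply: ord_inj.
by exists i; apply/existsP; exists j; rewrite -jE !eqxx.
Qed.

(** Without its first entry the word is increasing, so after relabelling it is the identity by
    [increasing_perm_eq1]; the descent at position 1 makes the first entry positive. *)
Lemma descents_eq1P n (s : 'S_n.+1) :
  reflect (0 < s ord0 /\ s = lift_perm ord0 (s ord0) 1)
          (descents s == [:: 1]).
Proof.
apply: (iffP eqP) => [ds | [s0_gt0 sE]].
  have dsE (j : 'I_n.+1) : 0 < j -> descent_at s j = (j == 1 :> nat).
    move=> j_gt0; have := mem_filter (descent_at s) j (iota 1 n).
    by rewrite -[filter _ _]/(descents s) ds mem_iota j_gt0 add1n ltn_ord !andbT mem_seq1 => <-.
  have lt1n : 1 < n.+1.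
    have : 1 \in descents s by rewrite ds mem_head.
    by rewrite mem_filter mem_iota => /and3P[_ _].
  have := dsE (Ordinal lt1n) isT; rewrite (@descent_atE _ s ord0) //= => lt_s.
  split; first exact: leq_ltn_trans lt_s.
  have [u uE] := lift_perm_surj ord0 s; rewrite {1}uE.
  congr (lift_perm _ _ _); apply: increasing_perm_eq1 => i j jE.
  have := dsE (lift ord0 j) isT; rewrite (@descent_atE _ s (lift ord0 i)) /=; last first.
    by rewrite /bump jE.
  rewrite {1 2}uE !lift_perm_lift /= /bump jE.
  have : u i != u j :> nat.
    by apply/eqP=> /ord_inj/perm_inj ij; move: jE; rewrite ij; lia.
  by lia.
(* After the first entry, the values 0, 1, 2, ... are listed in order, skipping [s ord0]. *)
have sV (j : 'I_n.+1) : 0 < j -> s j = j.-1 + (s ord0 <= j.-1) :> nat.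
  case: (unliftP ord0 j) => [i ->|-> //] _.
  by rewrite {1}sE lift_perm_lift perm1 /= /bump; lia.
have dsE (j : 'I_n.+1) : 0 < j -> descent_at s j = (j == 1 :> nat).
  move=> j_gt0; have lt_j : j.-1 < n.+1 by apply: leq_ltn_trans (leq_pred _) (ltn_ord j).
  rewrite (@descent_atE _ s (Ordinal lt_j)) /=; last by rewrite prednK.
  rewrite (sV j) //; have [j1 | j_gt1] := posnP j.-1.
    have -> : Ordinal lt_j = ord0 by apply: ord_inj.
    by lia.
  by rewrite (sV (Ordinal lt_j)) //=; lia.
have n_gt0 : 0 < n by apply: leq_trans s0_gt0 _; rewrite -ltnS ltn_ord.
rewrite /descents (@eq_in_filter _ _ (pred1 1)) => [|j].
  by rewrite filter_pred1_uniq ?iota_uniq // mem_iota /=.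
rewrite mem_iota add1n => /andP[j_gt0 lt_jn].
exact: dsE (Ordinal lt_jn) j_gt0.
Qed.

Lemma sum_even_nat (F : nat -> nat) n :
  \sum_(1 <= k < n.+1) (if odd k then 0 else F k)
    = \sum_(1 <= i < (n %/ 2).+1) F (2 * i).
Proof.
elim: n => [|n IHn]; first by rewrite !big_geq.
rewrite big_nat_recr //= IHn; have [nodd | neven] := boolP (odd n); last first.
  by rewrite addn0; congr (\sum_(1 <= i < _) _); lia.
have -> : (n.+1 %/ 2).+1 = (n %/ 2).+2 by lia.
by rewrite [RHS]big_nat_recr //=; congr (_ + F _); lia.
Qed.

Theorem theorem4p2 (n : nat) (hn : 1 <= n) :
  #|[set p : 'S_n | descents (p ^+ 2)%g == [:: 1]]| =
  \sum_(1 <= i < (n.-1 %/ 2).+1) #|involutions (n - (2 * i + 1))|.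
Proof.
case: n hn => // n _; rewrite /= -sum1_card.
rewrite (partition_big (fun p : 'S_n.+1 => (p ^+ 2)%g ord0) (fun k => 0 < k)) /=; last first.
  by move=> p; rewrite inE => /descents_eq1P[].
under [RHS]eq_bigr => i _ do rewrite addn1 subSS.
rewrite -(sum_even_nat (fun k => #|involutions (n - k)|)).
under eq_bigr => k k_gt0.
  rewrite sum1_card (_ : #|_| = if odd k then 0 else #|involutions (n - k)|); last first.
    rewrite -card_sqrt_cycle //; apply: eq_card => p; rewrite !inE unfold_in inE.
    apply/andP/eqP => [[/descents_eq1P[_ pE] /eqP <-] // | p2].
    split; last by rewrite p2 lift_perm_id.
    by apply/descents_eq1P; rewrite p2 lift_perm_id.
  over.
(* The sum over ordinals becomes one over naturals, and the condition [0 < k] becomes the lower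
   bound 1. *)
rewrite -(big_mkord (fun k => 0 < k) (fun k => if odd k then 0 else #|involutions (n - k)|)).
rewrite big_ltn_cond //= big_nat_cond [RHS]big_nat_cond.
by apply: eq_bigl => k; case: k.
Qed.
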